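(* Let $\pi$ be an $\mathbb F_q$-subplane of the transversal plane $\Gamma$ (equivalently, let $\bar\pi$ be an $\mathbb F_q$-subplane of $\mathrm{PG}(2,q^3)$ in the Bose representation). Then in $\mathrm{PG}(8,q)$ the planes $\{[X] : X\in\pi\}$ form one system of maximal spaces of a Segre variety $\mathcal S_{2;2}$.
   Context: $q$ is a prime power; $\mathrm{PG}(8,q)\subset\mathrm{PG}(8,q^3)$; for a point $X=(x_0,\dots,x_8)$, $X^q=(x_0^q,\dots,x_8^q)$ and $\Sigma^q=\{X^q:X\in\Sigma\}$ for a subspace $\Sigma$. Let $\Gamma$ be a plane of $\mathrm{PG}(8,q^3)$ disjoint from $\mathrm{PG}(8,q)$ such that $\Gamma,\Gamma^q,\Gamma^{q^2}$ span $\mathrm{PG}(8,q^3)$. For $X\in\Gamma$, $[X]=\langle X,X^q,X^{q^2}\rangle\cap\mathrm{PG}(8,q)$ is a plane, and these planes form a regular $2$-spread of $\mathrm{PG}(8,q)$; the Bose representation identifies points of $\mathrm{PG}(2,q^3)$ with points of $\Gamma\cong\mathrm{PG}(2,q^3)$ and with spread planes $[X]$. An $\mathbb F_q$-subplane is a subplane projectively equivalent to $\mathrm{PG}(2,q)$. A Segre variety $\mathcal S_{2;2}$ of $\mathrm{PG}(8,q)$ is (up to projectivity) the image of $\mathrm{PG}(2,q)\times\mathrm{PG}(2,q)$ under the Segre map $((x_i),(y_j))\mapsto(x_iy_j)$; it has two systems of maximal subspaces (planes). *)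

(* Defs.v *)
From HB Require Import structures.
From mathcomp Require Import all_boot all_order all_algebra.
From mathcomp Require Import finfield classical_sets.

Set Implicit Arguments.
Unset Strict Implicit.
Unset Printing Implicit Defensive.
Import GRing.Theory.
Local Open Scope ring_scope.
Local Open Scope classical_set_scope.

(* A (projective) subspace of PG(n-1, K) is a vector subspace of K^n; points,
   lines, planes, ... have vector dimension 1, 2, 3, ..., and a set of points
   (or of planes) is a classical set of vector subspaces. *)
Definition points (K : fieldType) (V : vectType K) (U : {vspace V}) :
  set {vspace V} := [set P | \dim P = 1%N /\ (P <= U)%VS].

(* The fields F and L stand for F_q and F_{q^3}, with iota the inclusion, so
   that q is #|F|.  All these types being finite, [seq f v | v in U] lists the
   images of all the vectors of U. *)
Section Bose.
Variables (F L : finFieldType) (iota : {rmorphism F -> L}).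

Definition conjq_vec n (v : 'rV[L]_n) : 'rV[L]_n :=
  map_mx (fun a => a ^+ #|F|) v.

Definition conjq n (U : {vspace 'rV[L]_n}) : {vspace 'rV[L]_n} :=
  <<[seq conjq_vec v | v in U]>>%VS.

Definition extend n (U : {vspace 'rV[F]_n}) : {vspace 'rV[L]_n} :=
  <<[seq map_mx iota v | v in U]>>%VS.

(* PG(n-1, q) as a set of points of PG(n-1, q^3) *)
Definition subgeometry n : set {vspace 'rV[L]_n} :=
  @extend n @` points fullv.

(* The intersection of U with PG(n-1, q), as a subspace of PG(n-1, q) *)
Definition restrict n (U : {vspace 'rV[L]_n}) : {vspace 'rV[F]_n} :=
  <<[seq v <- enum 'rV[F]_n | map_mx iota v \in U]>>%VS.

Definition bose n (X : {vspace 'rV[L]_n}) : {vspace 'rV[F]_n} :=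
  restrict (X + conjq X + conjq (conjq X))%VS.

(* G is the projective plane of which pi is a subplane: pi is the image of the
   standard PG(2, q) under a projectivity from PG(2, q^3) onto G. *)
Definition Fq_subplane n (G : {vspace 'rV[L]_n}) (pi : set {vspace 'rV[L]_n}) :=
  exists f : 'Hom('rV[L]_3, 'rV[L]_n),
    [/\ lker f == 0%VS, limg f = G &
        pi = [set (f @: P)%VS | P in @subgeometry 3]].

Lemma conjqD (x y : L) : (x + y) ^+ #|F| = x ^+ #|F| + y ^+ #|F|.
Proof.
have [p p_pr pF] := finPcharP F.
have pL : p \in [pchar L] by rewrite (fmorph_pchar iota).
have pi_q : [pchar L].-nat #|F|.
  by rewrite (card_pprimeChar pF) (eq_pnat _ (pcharf_eq pL)) pnatX pnat_id.
exact: exprDn_pchar.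
Qed.

Lemma conjq_surj (c : L) : exists d, c = d ^+ #|F|.
Proof.
have inj : injective (fun x : L => x ^+ #|F|).
  move=> x y /= exy; apply/eqP; rewrite -subr_eq0.
  have : (x - y) ^+ #|F| = 0.
    by apply/(@addIr _ (y ^+ #|F|)); rewrite -conjqD subrK exy add0r.
  by move/eqP; rewrite expf_eq0 => /andP[].
by exists (invF inj c); rewrite (f_invF inj).
Qed.

(* The vector subspace conjq U consists exactly of the conjugates of the
   vectors of U. *)
Lemma mem_conjq n (U : {vspace 'rV[L]_n}) w :
  reflect (exists2 u, u \in U & w = conjq_vec u) (w \in conjq U).
Proof.
apply: (iffP idP) => [|[u uU ->]]; last first.
  by apply/memv_span/mapP; exists u; rewrite ?mem_enum.
rewrite /conjq; set s := [seq _ | _ in _].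
have sP v : v \in s -> exists2 u, u \in U & v = conjq_vec u.
  by case/mapP=> u; rewrite mem_enum; exists u.
move=> /(@coord_span _ _ _ (in_tuple s)) ->.
elim/big_ind: _ => [|x y [u uU ->] [v vU ->]|i _].
- exists 0; rewrite ?mem0v //; apply/rowP=> j; rewrite !mxE expr0n.
  by rewrite (cardD1 0) inE.
- by exists (u + v); rewrite ?memvD //; apply/rowP=> j; rewrite !mxE conjqD.
have [u uU ->] : exists2 u, u \in U & s`_i = conjq_vec u by apply/sP/mem_nth.
have [d ->] := conjq_surj (coord (in_tuple s) i w).
by exists (d *: u); rewrite ?memvZ //; apply/rowP=> j; rewrite !mxE exprMn.
Qed.

Lemma mem_restrict n (U : {vspace 'rV[L]_n}) v :
  (v \in restrict U) = (map_mx iota v \in U).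
Proof.
apply/idP/idP => [|vU]; last first.
  by apply: memv_span; rewrite mem_filter mem_enum andbT; exact: vU.
rewrite /restrict; set s := [seq _ <- _ | _].
move=> /(@coord_span _ _ _ (in_tuple s)) ->.
elim/big_ind: _ => [|x y xU yU|i _].
- by rewrite map_mx0 mem0v.
- by rewrite map_mxD memvD.
rewrite map_mxZ memvZ //.
have : s`_i \in s by apply: mem_nth.
by rewrite mem_filter => /andP[].
Qed.

End Bose.

Arguments subgeometry {F L} iota n.
Arguments bose {F L} iota {n} X.

Section Segre.
Variable F : finFieldType.

(* mxvec lists the entries x_i y_j of the matrix x^T *m y. *)
Definition segre_vec (x y : 'rV[F]_3) : 'rV[F]_9 := mxvec (x^T *m y).

Definition segre_map (P Q : {vspace 'rV[F]_3}) : {vspace 'rV[F]_9} :=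
  <<[seq segre_vec x y | x <- enum P, y <- enum Q]>>%VS.

Definition PG2 : set {vspace 'rV[F]_3} := points fullv.

(* The image of the standard Segre variety under theta *)
Definition segre_image (theta : 'End('rV[F]_9)) : set {vspace 'rV[F]_9} :=
  [set X | exists2 P, PG2 P & exists2 Q, PG2 Q &
    X = (theta @: segre_map P Q)%VS].

Definition segre_variety (S : set {vspace 'rV[F]_9}) :=
  exists2 theta : 'End('rV[F]_9), lker theta == 0%VS & S = segre_image theta.

Definition maximal_space (S : set {vspace 'rV[F]_9}) (U : {vspace 'rV[F]_9}) :=
  points U `<=` S /\
  forall W : {vspace 'rV[F]_9}, points W `<=` S -> (U <= W)%VS -> W = U.

Definition system_l (theta : 'End('rV[F]_9)) : set {vspace 'rV[F]_9} :=
  [set U | exists2 P, PG2 P &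
    points U = [set (theta @: segre_map P Q)%VS | Q in PG2]].

Definition system_r (theta : 'End('rV[F]_9)) : set {vspace 'rV[F]_9} :=
  [set U | exists2 Q, PG2 Q &
    points U = [set (theta @: segre_map P Q)%VS | P in PG2]].

Definition maximal_system (S A : set {vspace 'rV[F]_9}) :=
  A `<=` maximal_space S /\
  exists theta : 'End('rV[F]_9),
    [/\ lker theta == 0%VS, S = segre_image theta &
        A = system_l theta \/ A = system_r theta].

Definition is_segre_system (A : set {vspace 'rV[F]_9}) :=
  exists2 S, segre_variety S & maximal_system S A.

End Segre.

(* Main.v *)
(* Let pi be the image of PG(2, q) under f : L^3 -> Gamma and put
   Tr u = u + u^q + u^(q^2).  Since L^9 is the direct sum of Gamma and its two
   conjugates, a vector a v + b v^q + c v^(q^2) with v in Gamma is fixed by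
   conjugation iff b v^q and c v^(q^2) are the conjugates of a v, so the spread
   plane of <f(x)> is {Tr (a f(x)) | a in L}.  The map (x, a) |-> Tr (a f(x)) is
   F-bilinear on F^3 x L and, again by directness, induces an isomorphism from
   the tensor product of F^3 and L, i.e. F^9, onto F^9; it maps the rulings
   x (x) L of the standard Segre variety to the spread planes.  A ruling is
   maximal because adding a suitable x (x) y to u (x) v, with u not
   proportional to x, gives a tensor of rank 2. *)
Require Import Defs.
From HB Require Import structures.
From mathcomp Require Import all_boot all_order all_algebra.
From mathcomp Require Import finfield classical_sets.

Set Implicit Arguments.
Unset Strict Implicit.
Unset Printing Implicit Defensive.
Import GRing.Theory.
Local Open Scope ring_scope.
Local Open Scope classical_set_scope.

(** Serves functions with a bare linearity proof: packing it into a linear structure makes [lfunE]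
    applicable. *)
Lemma linfunE (K : fieldType) (aT rT : vectType K) (g : aT -> rT) :
  linear g -> linfun g =1 g.
Proof.
move=> g_lin v.
pose gM := GRing.isLinear.Build K aT rT *:%R g g_lin.
pose gL : {linear aT -> rT} := HB.pack g gM.
exact: (lfunE gL).
Qed.

(** * Projective points as one-dimensional subspaces *)

Section Points.
Variables (K : fieldType) (V : vectType K).
Implicit Types (U P : {vspace V}) (v : V).

Lemma dim1_vline P : \dim P = 1%N -> exists2 v, v != 0 & P = <[v]>%VS.
Proof.
move=> dimP; have v0 : vpick P != 0 by rewrite vpick0 -dimv_eq0 dimP.
exists (vpick P) => //; apply/esym/eqP.
by rewrite eqEdim dimP dim_vline v0 -memvE memv_pick.
Qed.

Lemma points_vline U v : v != 0 -> v \in U -> points U <[v]>%VS.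
Proof. by move=> v0 vU; split; rewrite ?dim_vline ?v0 // -memvE. Qed.

Lemma points_sub U U' : points U `<=` points U' -> (U <= U')%VS.
Proof.
move=> sUU'; apply/subvP => u uU.
have [->|u0] := eqVneq u 0; first exact: mem0v.
by have [_] := sUU' _ (points_vline u0 uU); rewrite -memvE.
Qed.

Lemma points_inj : injective (@points K V).
Proof.
by move=> U U' e; apply/eqP; rewrite eqEsubv !points_sub // e.
Qed.

End Points.

Lemma points_fullP (K : fieldType) (V : vectType K) (P : {vspace V}) :
  points fullv P <-> exists2 v, v != 0 & P = <[v]>%VS.
Proof.
split=> [[/dim1_vline//]|[v v0 ->]]; exact: points_vline (memvf v).
Qed.

Lemma limg_inj (K : fieldType) (aT rT : vectType K) (f : 'Hom(aT, rT)) :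
  lker f == 0%VS -> injective (fun U => (f @: U)%VS).
Proof.
by move=> f0 U V e; apply/eqP; rewrite eqEsubv -!(limg_ker0 _ _ f0) e subvv.
Qed.

(** * Frobenius conjugation and descent to F *)

Section Frobenius.
Variables (F L : finFieldType) (iota : {rmorphism F -> L}).
Local Notation conj := (conjq_vec F).

(** The polynomial X^q - X is the product of the X - b for b in F; mapped to L, its root a must
    equal some [iota b]. *)
Lemma frobenius_fixed (a : L) : a ^+ #|F| = a -> exists b, a = iota b.
Proof.
move=> aq.
have := congr1 (fun p => (map_poly iota p).[a]) (finField_genPoly F).
rewrite rmorphB /= map_polyXn map_polyX !hornerE aq subrr.
rewrite rmorph_prod horner_prod => /esym/eqP/prodf_eq0[b _].
rewrite rmorphB /= map_polyX map_polyC !hornerE subr_eq0 => /eqP ->.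
by exists b.
Qed.

Lemma conjq_vecD n (u v : 'rV[L]_n) : conj (u + v) = conj u + conj v.
Proof. by apply/rowP=> j; rewrite !mxE (conjqD iota). Qed.

Lemma conjq_vecZ n a (u : 'rV[L]_n) : conj (a *: u) = a ^+ #|F| *: conj u.
Proof. by apply/rowP=> j; rewrite !mxE exprMn. Qed.

Lemma conjq_vec_iota n (w : 'rV[F]_n) : conj (map_mx iota w) = map_mx iota w.
Proof. by apply/rowP=> j; rewrite !mxE -rmorphXn expf_card. Qed.

Lemma conjq_vec_fixed n (u : 'rV[L]_n) :
  conj u = u -> exists w, u = map_mx iota w.
Proof.
move=> cu.
have ex j : exists b, u 0 j == iota b.
  have [|b ->] := @frobenius_fixed (u 0 j); last by exists b.
  by rewrite -{2}cu mxE.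
exists (\row_j xchoose (ex j)); apply/rowP=> j.
by rewrite !mxE; exact/eqP/(xchooseP (ex j)).
Qed.

(* A family of size n has at most #|F| ^ n combinations over F, so it extends
   freely as long as this is less than #|L|. *)
Lemma free_family_exists n : (#|F| ^ n <= #|L|)%N ->
  exists e : 'cV[L]_n, forall y : 'rV[F]_n, map_mx iota y *m e = 0 -> y = 0.
Proof.
elim: n => [|n IHn] leL; first by exists 0 => y _; apply/rowP=> -[].
have ltL : (#|F| ^ n < #|L|)%N.
  apply: leq_trans leL; rewrite expnS ltn_Pmull ?finNzRing_gt1 //.
  by rewrite expn_gt0 (ltnW (finNzRing_gt1 F)).
have [e eP] := IHn (ltnW ltL).
pose g (y : 'rV[F]_n) := (map_mx iota y *m e) 0 0.
have [a aP] : exists a, a \notin codom g.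
  apply/existsP; rewrite -negb_forall; apply: contraL ltL => /forallP sg.
  rewrite -leqNgt -[n]mul1n -card_mx; apply: leq_trans (leq_image_card g _).
  by apply/subset_leq_card/fintype.subsetP => a _; apply: sg.
suff eP' (y : 'rV[F]_(1 + n)) : map_mx iota y *m col_mx a%:M e = 0 -> y = 0.
  by exists (col_mx a%:M e : 'cV_(1 + n)).
rewrite -[y]hsubmxK map_row_mx mul_row_col.
move: (lsubmx y) (rsubmx y) => y1 y2.
rewrite mul_mx_scalar.
have [-> |y1N0] := eqVneq y1 0.
  by rewrite map_mx0 scaler0 add0r => /eP ->; rewrite row_mx0.
move/eqP; rewrite addr_eq0 => /eqP/(congr1 (fun A : 'M_1 => A 0 0)).
rewrite !mxE => ea; case/negP: aP; apply/codomP.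
have b0 : y1 0 0 != 0.
  by apply: contraNneq y1N0 => y10; apply/eqP/matrixP=> i j; rewrite !ord1 y10 mxE.
(* Solving the relation y1 a + y2 e = 0 for a. *)
exists (- (y1 0 0)^-1 *: y2); rewrite /g map_mxZ -scalemxAl mxE.
have -> : a = (iota (y1 0 0))^-1 * (a * iota (y1 0 0)).
  by rewrite mulrCA mulVf ?fmorph_eq0 // mulr1.
by rewrite ea rmorphN fmorphV mulNr mulrN !mxE.
Qed.

Lemma extend_vline n (x : 'rV[F]_n) :
  extend iota <[x]> = <[map_mx iota x]>%VS.
Proof.
apply/eqP; rewrite eqEsubv; apply/andP; split.
  apply/span_subvP => ? /mapP[v]; rewrite mem_enum => /vlineP[k ->] ->.
  by rewrite map_mxZ memvZ ?memv_line.
by rewrite -memvE; apply/memv_span/mapP; exists x; rewrite ?mem_enum ?memv_line.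
Qed.

End Frobenius.

(** * Segre vectors and rulings *)

Section Segre.
Variable F : finFieldType.

Lemma segre_vecE (x y : 'rV[F]_3) i j :
  @vec_mx F 3 3 (segre_vec x y) i j = x 0 i * y 0 j.
Proof. by rewrite mxvecK !mxE big_ord1 !mxE. Qed.

Lemma segre_vec_neq0 (x y : 'rV[F]_3) :
  x != 0 -> y != 0 -> segre_vec x y != 0.
Proof.
move=> /rV0Pn[i xi] /rV0Pn[j yj].
apply: contraTneq isT => xy0; have := segre_vecE x y i j.
rewrite xy0 linear0 mxE => /esym/eqP.
by rewrite mulf_eq0 (negPf xi) (negPf yj).
Qed.

Lemma segre_vecZ (x y : 'rV[F]_3) a b :
  segre_vec (a *: x) (b *: y) = (a * b) *: segre_vec x y.
Proof.
rewrite /segre_vec [(a *: x)^T]linearZ /= -scalemxAl -scalemxAr scalerA.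
by rewrite linearZ.
Qed.

Lemma segre_vecZC (x y : 'rV[F]_3) a :
  segre_vec (a *: x) y = segre_vec x (a *: y).
Proof. by rewrite /segre_vec [(a *: x)^T]linearZ -scalemxAl scalemxAr. Qed.

Lemma segre_map_line (x y : 'rV[F]_3) :
  segre_map <[x]> <[y]> = <[segre_vec x y]>%VS.
Proof.
apply/eqP; rewrite eqEsubv; apply/andP; split.
  apply/span_subvP => ? /allpairsP[[u v] /= []]; rewrite !mem_enum.
  move=> /vlineP[a ->] /vlineP[b ->] ->.
  by rewrite segre_vecZ memvZ ?memv_line.
rewrite -memvE; apply/memv_span/allpairsP; exists (x, y).
by rewrite /= !mem_enum !memv_line.
Qed.

Lemma segre_line_maximal (x : 'rV[F]_3) (W : {vspace 'rV[F]_9}) :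
  x != 0 -> (forall y, segre_vec x y \in W) ->
  (forall w, w \in W -> exists u, exists v, w = segre_vec u v) ->
  forall w, w \in W -> exists y, w = segre_vec x y.
Proof.
move=> x0 sxW Wdec w wW; have [u [v def_w]] := Wdec w wW.
have [v0|/rV0Pn[j vj]] := eqVneq v 0.
  by exists 0; rewrite def_w v0 /segre_vec !mulmx0.
(* Any index other than [j] works: adding x (x) e_i then leaves column [j] of u (x) v unchanged. *)
pose i : 'I_3 := if j == 0 then 1 else 0.
have ij : j != i by rewrite /i; case: (eqVneq j 0) => [->|].
have [s [t st]] := Wdec _ (memvD wW (sxW (delta_mx 0 i))).
have E k l : u 0 k * v 0 l + x 0 k * (l == i)%:R = s 0 k * t 0 l.
  have dE : (delta_mx 0 i : 'rV[F]_3) 0 l = (l == i)%:R :> F by rewrite mxE eqxx.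
  by rewrite -dE -!segre_vecE -st def_w linearD [RHS]mxE.
(* Column [j] shows that u is a multiple of s, and column [i] then shows that x is one too. *)
have Ej k : u 0 k = s 0 k * (t 0 j / v 0 j).
  by rewrite mulrA -E (negPf ij) mulr0 addr0 mulfK.
pose c := t 0 i - t 0 j / v 0 j * v 0 i.
have Ei k : x 0 k = s 0 k * c.
  by rewrite mulrBr -E eqxx mulr1 mulrA -Ej addrC addKr.
have c0 : c != 0.
  by apply: contraNneq x0 => c0; apply/eqP/rowP=> k; rewrite Ei c0 mulr0 mxE.
(* Since x = c s with c nonzero, u is a multiple of x; the factor moves over to v. *)
exists ((t 0 j / v 0 j / c) *: v); rewrite def_w.
have -> : u = (t 0 j / v 0 j / c) *: x.
  by apply/rowP=> k; rewrite mxE Ei Ej [RHS]mulrCA divfK.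
exact: segre_vecZC.
Qed.

Variable theta : 'End('rV[F]_9).
Hypothesis theta_inj : lker theta == 0%VS.

Lemma theta_segre_neq0 x y :
  x != 0 -> y != 0 -> theta (segre_vec x y) != 0.
Proof.
move=> x0 y0; rewrite -(linear0 theta) (inj_eq (lker0P theta_inj)).
exact: segre_vec_neq0.
Qed.

Lemma points_ruling (x : 'rV[F]_3) (U : {vspace 'rV[F]_9}) : x != 0 ->
  (forall w, w \in U <-> exists y, w = theta (segre_vec x y)) ->
  points U = [set (theta @: segre_map <[x]> Q)%VS | Q in @PG2 F].
Proof.
move=> x0 UP; apply/seteqP; split=> [P [/dim1_vline[w w0 ->]]|? [Q]].
  rewrite -memvE => /UP[y def_w].
  have y0 : y != 0.
    by apply: contraNneq w0 => y0; rewrite def_w y0 /segre_vec mulmx0 !linear0.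
  exists <[y]>%VS; first by apply/points_fullP; exists y.
  by rewrite segre_map_line limg_line def_w.
move=> /points_fullP[y y0 ->] <-; rewrite segre_map_line limg_line.
by apply: points_vline; [exact: theta_segre_neq0 | apply/UP; exists y].
Qed.

Lemma ruling_maximal (x : 'rV[F]_3) (U : {vspace 'rV[F]_9}) : x != 0 ->
  (forall w, w \in U <-> exists y, w = theta (segre_vec x y)) ->
  maximal_space (segre_image theta) U.
Proof.
move=> x0 UP; have Px : PG2 <[x]>%VS by apply/points_fullP; exists x.
split=> [P|W sW sUW].
  by rewrite (points_ruling x0 UP) => -[Q PQ <-]; exists <[x]>%VS => //; exists Q.
(* Pulling W back along [theta] reduces the claim to the standard Segre variety. *)
pose W' := (theta @^-1: W)%VS.
have memW' w : (w \in W') = (theta w \in W).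
  by rewrite -memv_preim.
apply/eqP; rewrite eqEsubv sUW andbT; apply/subvP => w wW.
have thK := lker0_lfunVK theta_inj.
have [|||y def_y] := segre_line_maximal (W := W') x0 _ _ (w := (theta^-1)%VF w).
- by move=> y; rewrite memW'; apply: (subvP sUW); apply/UP; exists y.
- move=> v; rewrite memW' => tvW.
  (* The zero vector spans no point, so it is decomposed by hand. *)
  have [v0|v0] := eqVneq v 0.
    by exists 0; exists 0; rewrite v0 /segre_vec mulmx0 linear0.
  have tv0 : theta v != 0 by rewrite -(linear0 theta) (inj_eq (lker0P theta_inj)).
  have [P /points_fullP[a _ ->] [Q /points_fullP[b _ ->]]] :=
    sW _ (points_vline tv0 tvW).
  rewrite segre_map_line -limg_line => /(limg_inj theta_inj) e.
  have /vlineP[k ->] : v \in <[segre_vec a b]>%VS by rewrite -e memv_line.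
  by exists (k *: a); exists (1 *: b); rewrite segre_vecZ mulr1.
- by rewrite memW' thK.
by apply/UP; exists y; rewrite -def_y thK.
Qed.

End Segre.

(** * Spread planes over a subplane *)

Section BoseSegre.
Variables (F L : finFieldType) (iota : {rmorphism F -> L}).
Hypothesis cardL : #|L| = (#|F| ^ 3)%N.
Variable f : 'Hom('rV[L]_3, 'rV[L]_9).
Hypothesis f_inj : lker f == 0%VS.
Hypothesis span_f :
  (limg f + conjq F (limg f) + conjq F (conjq F (limg f)) = fullv)%VS.
Local Notation conj := (conjq_vec F).

Lemma conjq_vecK3 n (u : 'rV[L]_n) : conj (conj (conj u)) = u.
Proof.
apply/rowP=> j; rewrite !mxE -!exprM -[RHS]expf_card cardL.
by rewrite !expnS expn0 muln1 mulnA.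
Qed.

Definition conj_sum (z : 'rV[L]_3 * 'rV[L]_3 * 'rV[L]_3) : 'rV[L]_9 :=
  f z.1.1 + conj (f z.1.2) + conj (conj (f z.2)).

(* [conj_sum] is onto by [span_f], between sets of the same cardinality: this
   is the directness of the sum of the three conjugates of [limg f]. *)
Lemma conj_sum_inj : injective conj_sum.
Proof.
have surj w : w \in codom conj_sum.
  have : w \in fullv by exact: memvf.
  rewrite -span_f => /memv_addP[u /memv_addP[u1 u1f [u2 u2f ->]] [u3 u3f ->]].
  have /memv_imgP[z1 _ ->] := u1f.
  have /(mem_conjq iota)[_ /memv_imgP[z2 _ ->] ->] := u2f.
  have /(mem_conjq iota)[_ /(mem_conjq iota)[_ /memv_imgP[z3 _ ->] ->] ->] := u3f.
  by apply/codomP; exists (z1, z2, z3).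
apply/injectiveP/card_uniqP; rewrite size_map -cardT.
rewrite (eq_card (B := 'rV[L]_9)) // !card_prod !card_mx.
by rewrite -!expnD.
Qed.

(** The map z |-> Tr (f z), as the diagonal of [conj_sum]. *)
Let trace z := conj_sum (z, z, z).

Lemma trace_fixed z : conj (trace z) = trace z.
Proof.
by rewrite /trace /conj_sum !(conjq_vecD iota) conjq_vecK3 addrC addrA.
Qed.

(** Conjugation has order dividing 3, so it permutes the three arguments cyclically; injectivity of
    [conj_sum] then compares them one by one. *)
Lemma conj_sum_traceP z1 z2 z3 :
  conj (conj_sum (z1, z2, z3)) = conj_sum (z1, z2, z3) -> z1 = z2 /\ z2 = z3.
Proof.
have -> : conj (conj_sum (z1, z2, z3)) = conj_sum (z3, z1, z2).
  by rewrite /conj_sum /= !(conjq_vecD iota) conjq_vecK3 addrC addrA.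
by move/conj_sum_inj => [_ -> ->].
Qed.

Lemma traceD z z' : trace (z + z') = trace z + trace z'.
Proof.
rewrite /trace /conj_sum /= !linearD !(conjq_vecD iota) /=.
by rewrite [X in X + _ = _]addrACA [LHS]addrACA.
Qed.

(** Scalars from F are fixed by the q-th power, hence pass through both conjugations. *)
Lemma traceZ a z : trace (iota a *: z) = iota a *: trace z.
Proof.
rewrite /trace /conj_sum /= !linearZ /= !conjq_vecZ -!rmorphXn !expf_card.
by rewrite -!scalerDr.
Qed.

Lemma trace_eq0 z : trace z = 0 -> z = 0.
Proof.
have t0 : trace 0 = 0 by apply: (addIr (trace 0)); rewrite -traceD !add0r.
by rewrite -t0 => /conj_sum_inj[].
Qed.

Lemma mem_bose_trace (v : 'rV[L]_3) w :
  w \in bose iota (f @: <[v]>)%VS <->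
  exists a, map_mx iota w = trace (a *: v).
Proof.
rewrite /bose mem_restrict; split=> [|[a ->]].
  move/memv_addP=> [u /memv_addP[_ /memv_imgP[z1 z1v ->] [u2 u2f ->]] [u3 u3f]].
  have /(mem_conjq iota)[_ /memv_imgP[z2 _ ->] ->] := u2f.
  have /(mem_conjq iota)[_ /(mem_conjq iota)[_ /memv_imgP[z3 _ ->] ->] ->] := u3f.
  move=> def_w; have {}def_w : map_mx iota w = conj_sum (z1, z2, z3) by [].
  (* A vector over F is fixed by conjugation, so [z2] and [z3] both equal [z1], a multiple of v. *)
  have [|e12 e23] := @conj_sum_traceP z1 z2 z3.
    by rewrite -def_w conjq_vec_iota.
  move: def_w; rewrite -e23 -e12; have /vlineP[a ->] := z1v.
  by exists a.
have av : f (a *: v) \in (f @: <[v]>)%VS.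
  by rewrite memv_img // memvZ ?memv_line.
rewrite /trace /conj_sum /=.
apply/memv_addP; exists (f (a *: v) + conj (f (a *: v))).
  apply/memv_addP; exists (f (a *: v)) => //; exists (conj (f (a *: v))) => //.
  by apply/(mem_conjq iota); exists (f (a *: v)).
exists (conj (conj (f (a *: v)))) => //.
apply/(mem_conjq iota); exists (conj (f (a *: v))) => //.
by apply/(mem_conjq iota); exists (f (a *: v)).
Qed.

(* theta sends the Segre vector of x and y to Tr(a f(x)), where a is the element
   of L with coordinates y in some basis e of L over F. *)
Lemma bose_segre : exists2 theta : 'End('rV[F]_9), lker theta == 0%VS &
  forall x w, w \in bose iota (f @: <[map_mx iota x]>)%VS <->
    exists y, w = theta (segre_vec x y).
Proof.
have [e eP] : exists e : 'cV[L]_3,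
    forall y : 'rV[F]_3, map_mx iota y *m e = 0 -> y = 0.
  by apply: free_family_exists; rewrite cardL.
have iota_inj : injective (map_mx iota : 'rV[F]_9 -> 'rV[L]_9).
  by apply: map_mx_inj; apply: fmorph_inj.
have ex z : exists w, trace z == map_mx iota w.
  have [w tw] := conjq_vec_fixed iota (trace_fixed z).
  by exists w; apply/eqP.
(* Traces are fixed by conjugation, so they descend to F; [T z] is the descended vector. *)
pose T z := xchoose (ex z).
have TE z : map_mx iota (T z) = trace z by exact/esym/eqP/(xchooseP (ex z)).
(* The identification of the tensor product of F^3 and L with L^3: row i of the matrix of w lists
   the coordinates in [e] of the i-th entry. *)
pose emb (w : 'rV[F]_9) : 'rV[L]_3 :=
  (map_mx iota (@vec_mx F 3 3 w) *m e)^T.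
have lin : linear (T \o emb).
  move=> a u v; apply: iota_inj; rewrite map_mxD map_mxZ !TE -traceZ -traceD.
  congr trace; rewrite /emb linearP map_mxD map_mxZ mulmxDl -scalemxAl.
  by rewrite linearP.
exists (linfun (T \o emb)) => [|x w].
  apply/eqP/vspaceP => w; rewrite memv_ker memv0 (linfunE lin) /=.
  apply/eqP/eqP => [Tw0|->]; last first.
    by have := linfunE lin 0; rewrite linear0 => /esym.
  have /trace_eq0/(canRL (@trmxK _ _ _)) : trace (emb w) = 0.
    by rewrite -TE Tw0 map_mx0.
  rewrite trmx0 => Me0.
  suff vw0 : @vec_mx F 3 3 w = 0 by rewrite -[w](@vec_mxK F 3 3) vw0 linear0.
  (* Freeness of [e] kills the matrix row by row. *)
  apply/row_matrixP => i; rewrite row0; apply: eP.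
  by rewrite map_row -row_mul Me0 row0.
pose c (y : 'rV[F]_3) := (map_mx iota y *m e) 0 0.
have cS y : emb (segre_vec x y) = c y *: map_mx iota x.
  rewrite /emb mxvecK map_mxM -mulmxA [map_mx iota y *m e]mx11_scalar.
  by rewrite mul_mx_scalar linearZ /= map_trmx trmxK.
have c_inj : injective c.
  move=> y y' cyy'; apply/eqP; rewrite -subr_eq0; apply/eqP/eP.
  rewrite map_mxB mulmxBl; apply/eqP; rewrite subr_eq0; apply/eqP.
  by rewrite [LHS]mx11_scalar [RHS]mx11_scalar -!/(c _) cyy'.
(* [c] reads y as coordinates in [e]; being injective between sets of size q^3, it reaches every
   multiplier a in L. *)
have [c' c'K cK] : bijective c.
  by apply: inj_card_bij => //; rewrite card_mx cardL.
rewrite mem_bose_trace; split=> [[a wa]|[y ->]].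
  by exists (c' a); apply: iota_inj; rewrite (linfunE lin) /= TE cS cK.
by exists (c y); rewrite (linfunE lin) /= TE cS.
Qed.

Lemma bose_subplane_segre :
  is_segre_system
    [set bose iota X | X in [set (f @: P)%VS | P in subgeometry iota 3]].
Proof.
have [theta theta_inj boseP] := bose_segre.
exists (segre_image theta); first by exists theta.
set A := [set _ | _ in _].
have AP U : A U <-> exists2 x, x != 0 & U = bose iota (f @: <[map_mx iota x]>)%VS.
  split=> [[_ [_ [_ /points_fullP[x x0 ->] <-] <-] <-]|[x x0 ->]].
    by exists x; rewrite ?extend_vline.
  exists (f @: <[map_mx iota x]>)%VS => //; exists <[map_mx iota x]>%VS => //.
  by exists <[x]>%VS; rewrite ?extend_vline //; apply/points_fullP; exists x.
split=> [U /AP[x x0 ->]|]; first exact: ruling_maximal (boseP x).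
(* The first factor x of the tensor is fixed along a spread plane, whence the left system. *)
exists theta; split=> //; left; apply/seteqP; split=> U.
  move=> /AP[x x0 ->]; exists <[x]>%VS; first by apply/points_fullP; exists x.
  exact: points_ruling (boseP x).
move=> [_ /points_fullP[x x0 ->] eU]; apply/AP; exists x => //.
by apply: points_inj; rewrite eU (points_ruling theta_inj x0 (boseP x)).
Qed.

End BoseSegre.

(** * Transfer of subplanes between PG(2, q^3) and its image *)

Lemma Fq_subplane_limg (F L : finFieldType) (iota : {rmorphism F -> L}) m n
    (beta : 'Hom('rV[L]_m, 'rV[L]_n)) (pi : set {vspace 'rV[L]_m}) :
  lker beta == 0%VS ->
  Fq_subplane iota fullv pi <->
  Fq_subplane iota (limg beta) [set (beta @: X)%VS | X in pi].
Proof.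
move=> beta_inj; split=> [[f [f_inj f_img ->]]|[f [f_inj f_img e]]].
  exists (beta \o f)%VF; split.
  - apply/lker0P => u v; rewrite !comp_lfunE.
    by move/(lker0P beta_inj)/(lker0P f_inj).
  - by rewrite limg_comp f_img.
  by rewrite image_comp; apply: eq_imagel => P _ /=; rewrite limg_comp.
(* [f] and [beta] have the same image, on which [beta^-1] is a right inverse of [beta]; so [f]
   factors through [beta]. *)
have betaK v : beta (beta^-1%VF (f v)) = f v.
  by apply: limg_lfunVK; rewrite -f_img memv_img ?memvf.
have fE : f = (beta \o (beta^-1 \o f))%VF.
  by apply/lfunP => v; rewrite !comp_lfunE betaK.
exists (beta^-1 \o f)%VF; split.
- apply/lker0P => u v; rewrite !comp_lfunE => /(congr1 beta).
  by rewrite !betaK; apply: (lker0P f_inj).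
- by apply: (limg_inj beta_inj); rewrite -limg_comp -fE.
have imgE P : (beta @: ((beta^-1 \o f) @: P) = f @: P)%VS.
  by rewrite -limg_comp -fE.
apply/seteqP; split=> X.
  move=> piX; have : [set (beta @: X)%VS | X in pi] (beta @: X)%VS by exists X.
  rewrite e => -[P sP eP]; exists P => //.
  by apply: (limg_inj beta_inj); rewrite imgE.
move=> [P sP <-]; have : [set (f @: P)%VS | P in subgeometry iota 3] (f @: P)%VS.
  by exists P.
by rewrite -e => -[Y piY]; rewrite -imgE => /(limg_inj beta_inj) <-.
Qed.

Theorem theorem6p1 (F L : finFieldType) (iota : {rmorphism F -> L})
    (cardL : #|L| = (#|F| ^ 3)%N)
    (Gamma : {vspace 'rV[L]_9}) (dimG : \dim Gamma = 3%N)
    (disjG : points Gamma `&` subgeometry iota 9 = set0)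
    (spanG : (Gamma + conjq F Gamma + conjq F (conjq F Gamma) = fullv)%VS) :
  (forall pi : set {vspace 'rV[L]_9},
     Fq_subplane iota Gamma pi -> is_segre_system [set bose iota X | X in pi])
  /\
  (forall beta : 'Hom('rV[L]_3, 'rV[L]_9),
     lker beta == 0%VS -> limg beta = Gamma ->
     forall pibar : set {vspace 'rV[L]_3},
       (Fq_subplane iota fullv pibar <->
        Fq_subplane iota Gamma [set (beta @: X)%VS | X in pibar]) /\
       (Fq_subplane iota fullv pibar ->
        is_segre_system [set bose iota (beta @: X)%VS | X in pibar])).
Proof.
have subplane_segre pi : Fq_subplane iota Gamma pi ->
    is_segre_system [set bose iota X | X in pi].
  by move=> [f [f_inj fG ->]]; apply: bose_subplane_segre; rewrite ?fG.
split=> // beta beta_inj betaG pibar.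
have eqv := Fq_subplane_limg iota pibar beta_inj; rewrite betaG in eqv.
split=> // /eqv/subplane_segre; by rewrite image_comp.
Qed.
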